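(* There is an absolute constant $\rho_*>0$ (independent of $n,\epsilon,\delta,D$) such that the following holds for every $\bar\rho\ge\rho_*$. Put $$\hat\rho := 3.05+2.1\,\bar\rho+0.6\,\bar\rho^2+0.01\,\bar\rho^3 .$$ Let $n\ge 5$ be an integer and let $\epsilon,\delta$ be real numbers with $$0<\delta\le\epsilon,\qquad n\epsilon\le 1,\qquad \hat\rho\,\epsilon^2\le\tfrac12\delta .$$ Let $D=\mathrm{diag}(d_1,\dots,d_n)$ with $\min_i d_i=0$ and $\max_i d_i=1$, and let $f(x)=\tfrac12x^TA_\epsilon x$ on $\mathbb{R}^n$ with $A_\epsilon=\delta I+(1-\delta)\mathbf 1\mathbf 1^T+\epsilon D$. Then there is a constant $C$, independent of $t$ and $x^0$, such that for every starting point $x^0\in\mathbb{R}^n$ the iterates of random-permutations cyclic coordinate descent (RPCD) with exact line search applied to $f$ satisfy, for all $t=1,2,\dots$, $$\mathbb{E}_{P_1,\dots,P_t}\, f(x^{tn})\;\le\; C\,(1-1.4\,\delta)^t\,t\,\epsilon\,\|x^0\|^2 ,$$ so that the ratio of the bounds for $t+1$ and $t$ epochs tends to $1-1.4\delta$ as $t\to\infty$.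
   Context: $\mathbf 1=(1,\dots,1)^T\in\mathbb{R}^n$, $e_i$ is the $i$th coordinate vector, and $\|\cdot\|$ is the Euclidean norm. RPCD with exact line search: starting from $x^0$, at the start of each epoch $\ell=0,1,2,\dots$ a permutation $\pi_{\ell+1}$ of $\{1,\dots,n\}$ (with permutation matrix $P_{\ell+1}$) is drawn uniformly at random, independently of all previous ones. For $j=0,1,\dots,n-1$, with $k=\ell n+j$ and $i=\pi_{\ell+1}(j+1)$, set $x^{k+1}=x^k-\alpha_k[\nabla f(x^k)]_ie_i$, where $\alpha_k$ exactly minimizes $f$ along this line; that is, $x^{k+1}=x^k-\frac{(A_\epsilon x^k)_i}{(A_\epsilon)_{ii}}e_i$. Thus $x^{tn}$ is the iterate after $t$ epochs, and the expectation is over the random permutations of the first $t$ epochs. *)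

(* Defs.v *)
From HB Require Import structures.
From mathcomp Require Import all_boot all_order all_fingroup all_algebra.
From mathcomp Require Import all_classical all_reals all_analysis.
From mathcomp Require Import finmap ring lra.

Set Implicit Arguments.
Unset Strict Implicit.
Unset Printing Implicit Defensive.

Import Order.TTheory GRing.Theory Num.Theory.
Import numFieldNormedType.Exports.

Local Open Scope classical_set_scope.
Local Open Scope ring_scope.

(* The library norm on matrices is the max norm, hence this definition. *)
Definition euclid_norm (R : realType) (n : nat) (x : 'cV[R]_n) : R :=
  Num.sqrt (\sum_i x i 0 ^+ 2).

Definition A_eps (R : realType) (n : nat) (eps delta : R) (d : 'rV[R]_n)
    : 'M[R]_n :=
  let ones : 'cV[R]_n := const_mx 1 in
  delta%:M + (1 - delta) *: (ones *m ones^T) + eps *: diag_mx d.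

Definition quad (R : realType) (n : nat) (A : 'M[R]_n) (x : 'cV[R]_n) : R :=
  2^-1 * (x^T *m A *m x) 0 0.

(* [A *m x] is the gradient of [quad A] at [x] for symmetric [A], and
   [(A i i)^-1] is the steplength of the exact line search along the [i]-th
   coordinate; see [cd_step_exact]. *)
Definition cd_step (R : realType) (n : nat) (A : 'M[R]_n) (x : 'cV[R]_n)
    (i : 'I_n) : 'cV[R]_n :=
  x - ((A *m x) i 0 / A i i) *: delta_mx i 0.

Lemma cd_step_exact (R : realType) (n : nat) (A : 'M[R]_n) (x : 'cV[R]_n)
    (i : 'I_n) (a : R) :
  A^T = A -> 0 < A i i ->
  quad A (cd_step A x i) <= quad A (x + a *: delta_mx i 0).
Proof.
move=> sA Aii.
have Q b : quad A (x + b *: delta_mx i 0) =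
    quad A x + b * (A *m x) i 0 + 2^-1 * b ^+ 2 * A i i.
  set e : 'cV[R]_n := delta_mx i 0.
  have eA (y : 'cV[R]_n) : (e^T *m y) 0 0 = y i 0.
    by rewrite /e trmx_delta -rowE mxE.
  have xe : x^T *m A *m e = (e^T *m (A *m x))^T.
    by rewrite !trmx_mul trmxK sA.
  have exp : (x + b *: e)^T *m A *m (x + b *: e) =
      x^T *m A *m x + b *: (x^T *m A *m e)
      + (b *: (e^T *m (A *m x)) + b *: (b *: (e^T *m (A *m e)))).
    have -> : (x + b *: e)^T = x^T + b *: e^T by apply/matrixP => p q; rewrite !mxE.
    rewrite !(mulmxDl, mulmxDr) -!(scalemxAl, scalemxAr).
    by rewrite -!mulmxA addrACA.
  have Me (M N : 'M[R]_1) : (M + N) 0 0 = M 0 0 + N 0 0 by rewrite mxE.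
  have Ze (c : R) (M : 'M[R]_1) : (c *: M) 0 0 = c * M 0 0 by rewrite mxE.
  have Te (M : 'M[R]_1) : M^T 0 0 = M 0 0 by rewrite mxE.
  rewrite /quad exp xe !(Me, Ze, Te) !eA -[A *m e]colE [col _ _ _ _]mxE.
  by field.
have -> : cd_step A x i = x + (- ((A *m x) i 0 / A i i)) *: delta_mx i 0.
  by rewrite /cd_step scaleNr.
rewrite !Q; set g := (A *m x) i 0.
have -> : g = (g / A i i) * A i i by rewrite divfK // gt_eqF.
set u := g / A i i; rewrite mulfK ?gt_eqF //.
have : 0 <= A i i * (u + a) ^+ 2 by rewrite mulr_ge0 ?sqr_ge0 // ltW.
by nra.
Qed.

(* [enum 'I_n] lists the indices increasingly, so the coordinates are visited
   in the order s 0, ..., s (n - 1). *)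
Definition cd_epoch (R : realType) (n : nat) (A : 'M[R]_n) (s : 'S_n)
    (x : 'cV[R]_n) : 'cV[R]_n :=
  foldl (fun y j => cd_step A y (s j)) x (enum 'I_n).

(* The iterate after [t] epochs (x^{tn}); [s l] is the permutation used in
   epoch [l = 0, 1, ...]. *)
Fixpoint rpcd (R : realType) (n : nat) (A : 'M[R]_n) (s : nat -> 'S_n)
    (x0 : 'cV[R]_n) (t : nat) : 'cV[R]_n :=
  if t is t'.+1 then cd_epoch A (s t') (rpcd A s x0 t') else x0.

(* ['S_n] is taken with its discrete sigma-algebra. *)
Definition iid_uniform_perms (d : measure_display) (T : measurableType d)
    (R : realType) (P : probability T R) (n : nat) (sigma : nat -> T -> 'S_n)
    : Prop :=
  [/\ forall l (B : set 'S_n), measurable (sigma l @^-1` B),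
      forall l (s : 'S_n), P (sigma l @^-1` [set s]) = (n`!%:R^-1)%:E
    & forall (I : {fset nat}) (B : nat -> set 'S_n),
        P (\bigcap_(l in [set` I]) (sigma l @^-1` B l)) =
        (\prod_(l <- I) P (sigma l @^-1` B l))%E].

Definition rho_hat (R : realType) (rho : R) : R :=
  305 / 100 + 21 / 10 * rho + 6 / 10 * rho ^+ 2 + 1 / 100 * rho ^+ 3.

Definition epoch_bound (R : realType) (n : nat) (C eps delta : R)
    (x0 : 'cV[R]_n) (t : nat) : R :=
  C * (1 - 14 / 10 * delta) ^+ t * t%:R * eps * euclid_norm x0 ^+ 2.

(* Main.v *)
Require Import Defs.
From HB Require Import structures.
From mathcomp Require Import all_boot all_order all_fingroup all_algebra.
From mathcomp Require Import all_classical all_reals all_analysis.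
From mathcomp Require Import measurable_realfun finmap ring lra.

Import Order.TTheory GRing.Theory Num.Theory.
Import numFieldNormedType.Exports.

Local Open Scope classical_set_scope.
Local Open Scope ring_scope.

(** Why the theorem holds.

    For this matrix, coordinate descent is a transport of mass.  Let [p] be
    minus the sum of the coordinates, and let
    [b_i = (delta + eps d_i) / (1 + eps d_i)], which lies between [delta] and
    [delta + eps].  A step along [i] replaces [x_i] by [(1 - b_i) (x_i + p)] and
    [p] by [b_i (x_i + p)] ([cd_step_relax], [coord_sum_relax]): coordinate [i]
    absorbs the pending mass [p], keeps a fraction [1 - b_i] and leaves a
    fraction [b_i] pending for the next coordinate in the sweep.

    To first order, coordinate [i] thus loses [b_i x_i], and its successor in the
    permutation receives this amount.  The squared norm changes by
    [- 2 sum_i b_i x_i^2] (the loss) plus twice the sum of [b_i x_i x_k] over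
    the consecutive pairs [(i, k)] (the transfers); everything else is
    [O(eps^2)] times the squared norm, or is controlled by [p^2] ([relax_ineq]
    for one step, [sweep_ineq] for a whole sweep).  A uniform permutation makes
    all ordered pairs equally likely to be consecutive, so the transfers average
    to [(1/n) sum_(i != k) b_i x_i x_k].  This is at most
    [(1/2) p^2 + O(eps^2) |x|^2], because its diagonal part enters with a
    negative sign ([sum_perm_cross]).

    Consequently [V(x) = |x|^2 + 8 (sum_i x_i)^2] satisfies
    [E V(x^{(l+1) n}) <= (1 - 2 delta + O(eps^2)) E V(x^{l n})], and
    [eps^2 <= delta / (2 rho_hat)] makes the error at most [0.6 delta] once
    [rho] is at least an absolute constant ([epoch_contraction]).  Since the
    epochs are independent, this iterates to
    [E V(x^{t n}) <= (1 - 1.4 delta)^t V(x^0)].  Finally [0 <= f <= V], and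
    [V(x^0) <= (1 + 8 n) |x^0|^2], which gives the bound for
    [C = (1 + 8 n) / eps] and all [t >= 1]. *)

(** * One coordinate step as a transport of mass *)

Definition coord_sum {R : realType} {n : nat} (x : 'cV[R]_n) : R := \sum_k x k 0.

Definition sqnorm {R : realType} {n : nat} (x : 'cV[R]_n) : R :=
  \sum_k x k 0 ^+ 2.

(** The Lyapunov function.  The first step of an epoch can turn the whole sum of
    the coordinates into a change of one coordinate, so the sum has to be
    penalized with a weight above the coefficient 6 that it gets in
    [epoch_avg]. *)
Definition potential {R : realType} {n : nat} (x : 'cV[R]_n) : R :=
  sqnorm x + 8 * coord_sum x ^+ 2.

Definition relax {R : realType} {n : nat} (b : 'I_n -> R) (x : 'cV[R]_n)
    (i : 'I_n) : 'cV[R]_n :=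
  \col_k if k == i then (1 - b i) * (x i 0 - coord_sum x) else x k 0.

Lemma coord_sum_relax {R : realType} {n : nat} (b : 'I_n -> R) (x : 'cV[R]_n) i :
  - coord_sum (relax b x i) = b i * (x i 0 - coord_sum x).
Proof.
have E : coord_sum (relax b x i) - coord_sum x =
    - coord_sum x + b i * (coord_sum x - x i 0).
  rewrite /coord_sum -sumrB (bigD1 i) //= big1 ?addr0; last first.
    by move=> k /negPf ki; rewrite !mxE ki subrr.
  by rewrite !mxE eqxx -/(coord_sum x); ring.
by lra.
Qed.

Lemma A_epsE {R : realType} {n : nat} (eps delta : R) (d : 'rV[R]_n) i j :
  A_eps eps delta d i j = (1 - delta) + (delta + eps * d 0 i) *+ (i == j).
Proof.
rewrite !mxE big_ord1 !mxE mulr1 mulr1.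
by case: (eqVneq i j) => [->|_] /=; rewrite ?mulr1n ?mulr0n; ring.
Qed.

Lemma A_eps_mulE {R : realType} {n : nat} (eps delta : R) (d : 'rV[R]_n)
    (x : 'cV[R]_n) i :
  (A_eps eps delta d *m x) i 0 =
  (1 - delta) * coord_sum x + (delta + eps * d 0 i) * x i 0.
Proof.
rewrite mxE; under eq_bigr => j _ do rewrite A_epsE mulrDl.
rewrite big_split /= -mulr_sumr; congr (_ + _).
rewrite (bigD1 i) //= eqxx mulr1n big1 ?addr0 // => j /negPf ji.
by rewrite eq_sym ji mulr0n mul0r.
Qed.

(** The fraction of its mass that a coordinate leaves to its successor. *)
Definition transfer {R : realType} {n : nat} (eps delta : R) (d : 'rV[R]_n)
    (i : 'I_n) : R := (delta + eps * d 0 i) / (1 + eps * d 0 i).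

Lemma cd_step_relax {R : realType} {n : nat} (eps delta : R) (d : 'rV[R]_n)
    (x : 'cV[R]_n) i :
  0 < 1 + eps * d 0 i ->
  cd_step (A_eps eps delta d) x i = relax (transfer eps delta d) x i.
Proof.
move=> pos; apply/colP => k; rewrite /cd_step A_eps_mulE A_epsE eqxx mulr1n.
rewrite !mxE andbT; case: (eqVneq k i) => [->|_] /=; last by rewrite mulr0 subr0.
have -> : 1 - delta + (delta + eps * d 0 i) = 1 + eps * d 0 i by ring.
by rewrite mulr1 /transfer; field; rewrite gt_eqF.
Qed.

(** When [h i = b i * x i] and [q] is the mass pending at the start of a sweep,
    this is the first-order part of the correlation between the coordinates and
    the masses that they absorb. *)
Fixpoint carry {R : realType} {I : Type} (h x : I -> R) (q : R) (l : seq I) : R :=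
  if l is i :: l' then q * x i + carry h x (h i) l' else 0.

Lemma eq_carry {R : realType} {I : eqType} (h x h' x' : I -> R) q (l : seq I) :
  {in l, h =1 h'} -> {in l, x =1 x'} -> carry h x q l = carry h' x' q l.
Proof.
elim: l q => //= i l IHl q hh xx.
rewrite xx ?hh ?mem_head // IHl // => k kl; [apply: hh|apply: xx];
  by rewrite in_cons kl orbT.
Qed.

(** The energy balance of one step, with [y] the coordinate that is visited and
    [p] the pending mass.  The latter is split as [q + b0 * p0]: the mass [q]
    left behind from the previous coordinate's own value, which has to be kept
    exactly in the product [q * y], and what was already pending one
    step earlier, [p0], of which only a fraction [b0] survived and whose product
    with [y] is therefore of second order.  The term [p ^+ 2] on the left pays
    for the [p0 ^+ 2] on the right in the next step. *)
Lemma relax_ineq {R : realType} (B b b0 y p q p0 : R) :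
  0 <= b <= B -> 0 <= b0 <= B -> B <= 1 / 4 -> p = q + b0 * p0 ->
  ((1 - b) * (y + p)) ^+ 2 + 8 * (b * (y + p)) ^+ 2 + p ^+ 2 <=
  (1 - 2 * b + 20 * B ^+ 2) * y ^+ 2 + 2 * (q * y) + 5 * p ^+ 2 + p0 ^+ 2.
Proof.
move=> /andP[b_ge0 bB] /andP[b0_ge0 b0B] B4 pE.
have bB2 : b ^+ 2 <= B ^+ 2 by rewrite ler_sqr ?nnegrE //; lra.
have b0B2 : b0 ^+ 2 <= B ^+ 2 by rewrite ler_sqr ?nnegrE //; lra.
have B16 : B ^+ 2 <= 1 / 16 by nra.
(* The correlation with the twice transferred mass is of second order. *)
have H1 : 2 * (y * (b0 * p0)) <= B ^+ 2 * y ^+ 2 + p0 ^+ 2.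
  by have := sqr_ge0 (b0 * y - p0); have := sqr_ge0 y; nra.
have qE : q * y = p * y - y * (b0 * p0) by rewrite pE; ring.
have H2 : 8 * (b * (y + p)) ^+ 2 <= 16 * B ^+ 2 * y ^+ 2 + p ^+ 2.
  have H : (y + p) ^+ 2 <= 2 * y ^+ 2 + 2 * p ^+ 2.
    by have := sqr_ge0 (y - p); lra.
  rewrite exprMn.
  have H' : b ^+ 2 * (y + p) ^+ 2 <= B ^+ 2 * (2 * y ^+ 2 + 2 * p ^+ 2).
    by apply: ler_pM; rewrite ?sqr_ge0.
  have := sqr_ge0 p; nra.
have H3 : ((1 - b) * (y + p)) ^+ 2 <=
    (1 - 2 * b + 3 * B ^+ 2) * y ^+ 2 + 2 * (p * y) + 3 * p ^+ 2.
  have -> : ((1 - b) * (y + p)) ^+ 2 =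
      (1 - 2 * b + b ^+ 2) * y ^+ 2 + 2 * (p * y)
      - 2 * (b * (2 - b) * y * p) + (1 - b) ^+ 2 * p ^+ 2 by ring.
  have b1 : (1 - b) ^+ 2 * p ^+ 2 <= p ^+ 2.
    rewrite ler_piMl ?sqr_ge0 //; nra.
  (* [b * (2 - b) <= 2 * B], so Young's inequality applies to the cross term. *)
  have c4 : (b * (2 - b)) ^+ 2 <= 2 * B ^+ 2 * 2 by nra.
  have b2 : - 2 * (b * (2 - b) * y * p) <= 2 * B ^+ 2 * y ^+ 2 + 2 * p ^+ 2.
    have := sqr_ge0 (b * (2 - b) * y + 2 * p).
    have : (b * (2 - b)) ^+ 2 * y ^+ 2 <= 2 * B ^+ 2 * 2 * y ^+ 2.
      by rewrite ler_wpM2r ?sqr_ge0.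
    nra.
  have b3 : b ^+ 2 * y ^+ 2 <= B ^+ 2 * y ^+ 2 by rewrite ler_wpM2r ?sqr_ge0.
  nra.
nra.
Qed.

(** * Sweeping through a list of coordinates *)

Lemma foldl_relax_notin {R : realType} {n : nat} (b : 'I_n -> R) (x : 'cV[R]_n)
    (l : seq 'I_n) k :
  k \notin l -> foldl (relax b) x l k 0 = x k 0.
Proof.
elim: l x => //= i l IHl x; rewrite inE => /norP[/negPf ki kl].
by rewrite IHl // mxE ki.
Qed.

(** Summation of [relax_ineq] along a sweep that visits each coordinate at most
    once.  The weight 8 of the squared sum is reproduced by the induction, but a
    single step already brings it down to 5, because the pending mass that leaves
    a step is smaller by a factor of order [B] than what the step acted on.  It
    is this gain that lets [potential] contract. *)
Lemma sweep_ineq {R : realType} {n : nat} (b : 'I_n -> R) (B : R)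
    (x : 'cV[R]_n) (l : seq 'I_n) (q b0 p0 : R) :
  (forall i, 0 <= b i <= B) -> B <= 1 / 4 -> uniq l ->
  0 <= b0 <= B -> - coord_sum x = q + b0 * p0 ->
  let x' := foldl (relax b) x l in
  \sum_(k <- l) x' k 0 ^+ 2 + 8 * coord_sum x' ^+ 2 <=
  \sum_(k <- l) (1 - 2 * b k + 20 * B ^+ 2) * x k 0 ^+ 2
  + 2 * carry (fun k => b k * x k 0) (fun k => x k 0) q l
  + (if nilp l then 8 else 5) * coord_sum x ^+ 2 + p0 ^+ 2.
Proof.
move=> bB B4; elim: l x q b0 p0 => [|i l IHl] x q b0 p0 /=.
  by move=> _ _ _; rewrite !big_nil mulr0 !add0r lerDl sqr_ge0.
move=> /andP[il ul] b0B pE; set x1 := relax b x i.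
rewrite !big_cons foldl_relax_notin //.
have x1i : x1 i 0 = (1 - b i) * (x i 0 + - coord_sum x) by rewrite mxE eqxx.
have x1l : {in l, forall k, x1 k 0 = x k 0}.
  by move=> k kl; rewrite mxE; case: eqP => // ki; rewrite -ki kl in il.
(* The split of the pending mass after the step: what [x i] itself leaves, and
   the surviving part of the mass that [i] has absorbed. *)
have p1E : - coord_sum x1 = b i * x i 0 + b i * (- coord_sum x).
  by rewrite coord_sum_relax; ring.
have := IHl x1 _ _ _ ul (bB i) p1E.
rewrite (eq_big_seq (fun k => (1 - 2 * b k + 20 * B ^+ 2) * x k 0 ^+ 2)); last first.
  by move=> k kl /=; rewrite x1l.
rewrite (@eq_carry _ _ _ _ (fun k => b k * x k 0) (fun k => x k 0)); last 2 first.
- by move=> k kl; rewrite x1l.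
- by move=> k kl; rewrite x1l.
have := @relax_ineq R B (b i) b0 (x i 0) (- coord_sum x) q p0 (bB i) b0B B4 pE.
have tE : b i * (x i 0 + - coord_sum x) = - coord_sum x1 by rewrite p1E; ring.
rewrite -x1i tE !sqrrN.
have : (if nilp l then 8 else 5) * coord_sum x1 ^+ 2 <= 8 * coord_sum x1 ^+ 2.
  by rewrite ler_wpM2r ?sqr_ge0 //; case: ifP => _; lra.
move=> H1 H2 /= H3; rewrite mulrDr.
rewrite -addrA; apply: le_trans (lerD (lexx _) H3) _; move: H1 H2.
move: (\sum_(_ <- _) _) (carry _ _ _ _) (if _ then _ else _) => u v w H1 H2; lra.
Qed.

(** * Averages over all permutations *)

Lemma sum_perm_at {R : realType} {n : nat} (g : 'I_n -> R) i :
  n%:R * (\sum_(s : 'S_n) g (s i)) = n`!%:R * \sum_k g k.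
Proof.
have E k : \sum_(s : 'S_n) g (s k) = \sum_(s : 'S_n) g (s i).
  rewrite (reindex_inj (mulgI (tperm i k))) /=.
  by apply: eq_bigr => s _; rewrite permM tpermR.
have -> : n%:R * \sum_(s : 'S_n) g (s i) = \sum_k \sum_(s : 'S_n) g (s k).
  by under [RHS]eq_bigr => k _ do rewrite E; rewrite sumr_const card_ord mulr_natl.
rewrite exchange_big /= (eq_bigr (fun=> \sum_k g k)); last first.
  by move=> s _; rewrite [RHS](reindex_inj (@perm_inj _ s)).
by rewrite sumr_const card_Sn mulr_natl.
Qed.

(** The symmetric group is 2-transitive, so each pair of consecutive positions
    contributes the average of [h i * x k] over all ordered pairs of distinct
    indices; the factor [n * (n - 1)] is their number. *)
Lemma sum_perm_carry {R : realType} {n : nat} (h x : 'I_n -> R) j js :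
  (2 <= n)%N -> uniq (j :: js) ->
  n%:R * (n%:R - 1) * \sum_(s : 'S_n) carry h x (h (s j)) [seq s k | k <- js] =
  (size js)%:R * n`!%:R * (\sum_k h k * (\sum_k' x k' - x k)).
Proof.
move=> n2.
have two i k : i != k ->
    n%:R * (n%:R - 1) * (\sum_(s : 'S_n) h (s i) * x (s k)) =
    n`!%:R * \sum_k h k * (\sum_k' x k' - x k).
  move=> ik.
  (* Composition with a transposition fixing [i] moves [k] to any [k' != i]. *)
  have E k' : k' != i ->
      \sum_(s : 'S_n) h (s i) * x (s k') = \sum_(s : 'S_n) h (s i) * x (s k).
    move=> k'i; rewrite (reindex_inj (mulgI (tperm k k'))) /=.
    apply: eq_bigr => s _; rewrite !permM tpermR tpermD //.
      by rewrite eq_sym.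
  have /= <- := sum_perm_at (fun i0 => h i0 * (\sum_k' x k' - x i0)) i.
  rewrite -mulrA; congr (_ * _).
  transitivity (\sum_(k' | k' != i) \sum_(s : 'S_n) h (s i) * x (s k')).
    under [RHS]eq_bigr => k' k'i do rewrite E //.
    rewrite sumr_const cardC1 card_ord -[RHS]mulr_natl; congr (_ * _).
    by rewrite -subn1 natrB // (leq_trans _ n2).
  rewrite exchange_big /=; apply: eq_bigr => s _.
  rewrite -mulr_sumr; congr (_ * _).
  rewrite [in RHS](reindex_inj (@perm_inj _ s)) /=.
  by rewrite [in RHS](bigD1 i) //= addrAC subrr add0r.
elim: js j => [|k js IHjs] j /=.
  by move=> _; rewrite big1 // mulr0 !mul0r.
move=> /and3P[]; rewrite inE => /norP[jk jjs] kjs ujs.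
rewrite big_split /= mulrDr two // IHjs /= ?kjs //.
by rewrite -[(size js).+1]addn1 natrD; ring.
Qed.

Lemma foldl_mapE {S T U : Type} (f : U -> T -> U) (g : S -> T) x (l : seq S) :
  foldl (fun y j => f y (g j)) x l = foldl f x [seq g j | j <- l].
Proof. by elim: l x => //= j l IHl x; rewrite IHl. Qed.

Lemma big_map_perm_enum {R : realType} {n : nat} (s : 'S_n) (F : 'I_n -> R) :
  \sum_(k <- [seq s j | j <- enum 'I_n]) F k = \sum_k F k.
Proof.
by rewrite big_map big_enum [RHS](reindex_inj (@perm_inj _ s)).
Qed.

(** On average the transfers do not increase the energy, up to the squared sum
    and second-order terms: the sum over distinct indices is the product of the
    two sums minus the nonnegative diagonal [sum_k b k * x k ^+ 2]. *)
Lemma sum_perm_cross {R : realType} {n : nat} (b x : 'I_n -> R) (B : R) j js :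
  (2 <= n)%N -> (forall i, 0 <= b i <= B) ->
  uniq (j :: js) -> size (j :: js) = n ->
  \sum_(s : 'S_n) 2 * carry (fun k => b k * x k) x (b (s j) * x (s j))
                       [seq s k | k <- js] <=
  n`!%:R * ((\sum_k x k) ^+ 2 + B ^+ 2 * \sum_k x k ^+ 2).
Proof.
move=> n2 bB uj sz; set X := \sum_k x k.
have n0 : 0 < n%:R :> R by rewrite ltr0n (leq_trans _ n2).
have n1 : 0 < n%:R - 1 :> R by rewrite subr_gt0 ltr1n.
have H := @sum_perm_carry R n (fun k => b k * x k) x j js n2 uj.
have sE : (size js)%:R = n%:R - 1 :> R.
  by have := congr1 (fun m : nat => m%:R : R) sz; rewrite /= -addn1 natrD; lra.
rewrite sE [n%:R * _]mulrC -!mulrA in H.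
have {}H := mulfI (lt0r_neq0 n1) H.
rewrite -mulr_sumr -(ler_pM2l n0) mulrCA [in leLHS]H mulrCA [leRHS]mulrCA.
rewrite ler_wpM2l ?ler0n //.
have nX : n%:R * X ^+ 2 = \sum_(k < n) X ^+ 2.
  by rewrite sumr_const card_ord mulr_natl.
rewrite mulrDr nX.
have S0 : 0 <= \sum_k x k ^+ 2 by apply: sumr_ge0 => k _; rewrite sqr_ge0.
apply: le_trans (_ : _ <= \sum_(k < n) X ^+ 2 + B ^+ 2 * \sum_k x k ^+ 2) _; last first.
  rewrite lerD2l; apply: ler_peMl; first by rewrite mulr_ge0 ?sqr_ge0.
  by rewrite ler1n (leq_trans _ n2).
rewrite !mulr_sumr -big_split /=; apply: ler_sum => k _; rewrite -/X.
have /andP[b0 bk] := bB k.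
have : b k ^+ 2 * x k ^+ 2 <= B ^+ 2 * x k ^+ 2.
  by rewrite ler_wpM2r ?sqr_ge0 // ler_sqr ?nnegrE //; lra.
have := mulr_ge0 b0 (sqr_ge0 (x k)); have := sqr_ge0 (b k * x k - X); lra.
Qed.

(** The pending mass [- coord_sum x] at the start of an epoch meets a uniformly
    distributed first coordinate; their product averages to
    [- coord_sum x ^+ 2 / n], which is nonpositive.  The remaining terms come
    from [sweep_ineq] and [sum_perm_cross]. *)
Lemma epoch_avg {R : realType} {n : nat} (b : 'I_n -> R) (c B : R)
    (x : 'cV[R]_n) :
  (2 <= n)%N -> 0 <= c -> (forall i, c <= b i <= B) -> B <= 1 / 4 ->
  \sum_(s : 'S_n) potential (foldl (fun y j => relax b y (s j)) x (enum 'I_n)) <=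
  n`!%:R * ((1 - 2 * c + 21 * B ^+ 2) * sqnorm x + 6 * coord_sum x ^+ 2).
Proof.
move=> n2 c0 cbB B4.
have n0 : 0 < n%:R :> R by rewrite ltr0n (leq_trans _ n2).
have bB i : 0 <= b i <= B by have /andP[ci ->] := cbB i; rewrite (le_trans c0).
have B0 : 0 <= B by have /andP[] := bB (Ordinal (leq_trans (isT : 0 < 2)%N n2)); lra.
have uE := enum_uniq 'I_n; have szE := size_enum_ord n.
case E: (enum 'I_n) => [|j js]; rewrite E in uE szE; first by rewrite -szE in n2.
set X := coord_sum x.
pose h k := b k * x k 0.
pose K := (1 - 2 * c + 20 * B ^+ 2) * sqnorm x + 5 * X ^+ 2.
have one (s : 'S_n) :
    potential (foldl (fun y j => relax b y (s j)) x (j :: js)) <=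
    K + 2 * (- X * x (s j) 0) +
    2 * carry h (fun k => x k 0) (h (s j)) [seq s k | k <- js].
  rewrite foldl_mapE; set l := [seq _ | _ <- _].
  have ul : uniq l by rewrite map_inj_uniq //; exact: perm_inj.
  have p0 : - coord_sum x = - X + 0 * 0 by rewrite mulr0 addr0.
  have z : 0 <= (0 : R) <= B by rewrite lexx.
  have /= := @sweep_ineq R n b B x l _ _ _ bB B4 ul z p0.
  have lE F : \sum_(k <- l) F k = \sum_k F k :> R.
    by rewrite /l -E big_map_perm_enum.
  rewrite (lE (fun k => _)) (lE (fun k => _ * _)).
  move=> H; apply: le_trans H _.
  rewrite expr0n /= addr0 -/X /l /= -/(h _).
  suff : \sum_k (1 - 2 * b k + 20 * B ^+ 2) * x k 0 ^+ 2 <=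
      (1 - 2 * c + 20 * B ^+ 2) * sqnorm x by rewrite /K; lra.
  rewrite /sqnorm mulr_sumr; apply: ler_sum => k _.
  rewrite ler_wpM2r ?sqr_ge0 //; have /andP[] := cbB k; lra.
apply: le_trans (ler_sum _ (fun s _ => one s)) _.
rewrite big_split /= big_split /= sumr_const card_Sn -[K *+ _]mulr_natl.
have C := @sum_perm_cross R n b (fun k => x k 0) B j js n2 bB uE szE.
have D : \sum_(s : 'S_n) 2 * (- X * x (s j) 0) <= 0.
  rewrite -mulr_sumr -mulr_sumr mulrA -(ler_pM2l n0) mulr0 mulrCA.
  rewrite (sum_perm_at (fun k => x k 0)) -/(coord_sum x) -/X.
  have : 0 <= n`!%:R * X ^+ 2 by rewrite mulr_ge0 ?ler0n ?sqr_ge0.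
  lra.
move: C; rewrite -/(sqnorm x) -/(coord_sum x) -/X => C.
apply: le_trans (lerD (lerD (lexx _) D) C) _.
rewrite addr0 -mulrDr ler_wpM2l ?ler0n // /K; lra.
Qed.

(** * Independent epochs *)

(** A one-step contraction in the mean iterates: summing over the first factor of
    the product last, the induction hypothesis applies to the state reached after
    the first step. *)
Lemma sum_tuple_foldl_le {R : realType} {S : finType} {U : Type}
    (f : U -> S -> U) (V Q : U -> R) (c : R) :
  0 <= c -> (forall x, Q x <= V x) -> (forall x, \sum_s V (f x s) <= c * V x) ->
  forall t x, \sum_(u : t.-tuple S) Q (foldl f x u) <= c ^+ t * V x.
Proof.
move=> c0 QV fV; elim=> [|t IHt] x.
  rewrite (big_pred1 (nil_tuple S)) ?expr0 ?mul1r //.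
  by move=> u; apply/esym/eqP; exact: tuple0.
rewrite (reindex (fun p : S * t.-tuple S => [tuple of p.1 :: p.2])) /=; last first.
  apply: onW_bij; exists (fun u : t.+1.-tuple S => (thead u, [tuple of behead u])).
    by move=> [s u] /=; rewrite theadE; congr pair; apply: val_inj.
  by move=> u; rewrite [RHS]tuple_eta.
rewrite -(pair_bigA _ (fun s (u : t.-tuple S) => Q (foldl f (f x s) u))) /=.
apply: le_trans (ler_sum _ (fun s _ => IHt (f x s))) _.
by rewrite -mulr_sumr exprSr -mulrA ler_wpM2l ?exprn_ge0.
Qed.

Lemma iid_cylinder {disp : measure_display} {T : measurableType disp}
    {R : realType} {P : probability T R} {n : nat} {sigma : nat -> T -> 'S_n} t
    (u : t.-tuple 'S_n) :
  iid_uniform_perms P sigma ->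
  let E := [set w | [seq sigma l w | l <- iota 0 t] = u] in
  measurable E /\ P E = ((n`!%:R^-1) ^+ t)%:E.
Proof.
move=> [mS uS iS] E.
pose I := [fset l in iota 0 t]%fset.
pose B l := [set nth 1%g u l].
have EE : E = \bigcap_(l in [set` I]) (sigma l @^-1` B l).
  apply/seteqP; split => w.
    move=> Ew l; rewrite /= !inE mem_iota /= add0n => lt_lt.
    by rewrite /B /= -Ew (nth_map 0) ?size_iota // nth_iota.
  move=> H; apply: (@eq_from_nth _ 1%g); first by rewrite size_map size_iota size_tuple.
  move=> l; rewrite size_map size_iota => lt_lt.
  rewrite (nth_map 0) ?size_iota // nth_iota // add0n.
  by apply: H; rewrite /= !inE mem_iota.
split; first by rewrite EE; apply: bigcap_measurableType => l _; exact: mS.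
rewrite EE iS; under eq_bigr => l _ do rewrite uS.
rewrite prodEFin big_const_seq iter_mulr_1; congr (_ ^+ _)%:E.
rewrite count_predT.
by rewrite card_fseq undup_id ?iota_uniq // size_iota.
Qed.

(** The observable takes finitely many values, each on a cylinder whose
    probability is given by [iid_cylinder]; nonnegativity makes the integral
    additive without an integrability condition. *)
Lemma expectation_iid_perms {disp : measure_display} {T : measurableType disp}
    {R : realType} {P : probability T R} {n : nat} {sigma : nat -> T -> 'S_n} t
    (G : seq 'S_n -> R) :
  iid_uniform_perms P sigma -> (forall u, 0 <= G u) ->
  ('E_P[fun w => G [seq sigma l w | l <- iota 0 t]])%E =
  ((n`!%:R^-1) ^+ t * \sum_(u : t.-tuple 'S_n) G u)%:E.
Proof.
move=> iid G0; rewrite unlock.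
pose E (u : t.-tuple 'S_n) := [set w | [seq sigma l w | l <- iota 0 t] = u].
have GE w : (G [seq sigma l w | l <- iota 0 t])%:E =
    (\sum_(u : t.-tuple 'S_n) (G u)%:E * (\1_(E u) w)%:E)%E.
  have sz : size [seq sigma l w | l <- iota 0 t] == t by rewrite size_map size_iota.
  rewrite (bigD1 (Tuple sz)) //= big1 ?adde0.
    by rewrite indicE mem_set ?mule1.
  move=> u ne; rewrite indicE memNset ?mule0 //.
  by move=> /= Eu; case/eqP: ne; apply: val_inj.
under eq_integral => w _ do rewrite GE.
rewrite ge0_integral_sum //=; last 2 first.
- move=> u; apply: measurable_funeM; apply/measurable_EFinP.
  by apply: measurable_indic; have [] := iid_cylinder t u iid.
- by move=> u w _; rewrite mule_ge0 ?lee_fin.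
rewrite mulr_sumr -sumEFin; apply: eq_bigr => u _.
have [mE PE] : measurable (E u) /\ P (E u) = (n`!%:R^-1 ^+ t)%:E.
  exact: iid_cylinder.
rewrite ge0_integralZl ?lee_fin //; last first.
  by apply/measurable_EFinP; exact: measurable_indic.
by rewrite integral_indic // setIT EFinM muleC; congr (_ * _)%E.
Qed.

Lemma rpcd_foldl {R : realType} {n : nat} (A : 'M[R]_n) (s : nat -> 'S_n) x t :
  rpcd A s x t = foldl (fun y p => cd_epoch A p y) x [seq s l | l <- iota 0 t].
Proof.
elim: t => // t IHt.
have -> : iota 0 t.+1 = rcons (iota 0 t) t by rewrite -addn1 iotaD add0n cats1.
by rewrite map_rcons foldl_rcons -IHt.
Qed.

(** * Contraction of the Lyapunov function and the rate *)

Lemma quad_A_epsE {R : realType} {n : nat} (eps delta : R) (d : 'rV[R]_n)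
    (x : 'cV[R]_n) :
  quad (A_eps eps delta d) x =
  2^-1 * ((1 - delta) * coord_sum x ^+ 2 +
          \sum_i (delta + eps * d 0 i) * x i 0 ^+ 2).
Proof.
rewrite /quad -mulmxA mxE; congr (_ * _).
under eq_bigr => i _ do rewrite A_eps_mulE mxE mulrDr.
rewrite big_split /= -mulr_suml -/(coord_sum x); congr (_ + _); first by ring.
by apply: eq_bigr => i _; ring.
Qed.

Lemma quad_A_eps_bounds {R : realType} {n : nat} {eps delta : R} {d : 'rV[R]_n}
    (x : 'cV[R]_n) :
  0 <= delta <= 1 / 2 -> 0 <= eps <= 1 / 2 -> (forall i, 0 <= d 0 i <= 1) ->
  0 <= quad (A_eps eps delta d) x <= potential x.
Proof.
move=> /andP[d0 d1] /andP[e0 e1] dd; rewrite quad_A_epsE /potential.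
have S0 : 0 <= \sum_i (delta + eps * d 0 i) * x i 0 ^+ 2.
  apply: sumr_ge0 => i _; rewrite mulr_ge0 ?sqr_ge0 //.
  by have /andP[di _] := dd i; have := mulr_ge0 e0 di; lra.
have S1 : \sum_i (delta + eps * d 0 i) * x i 0 ^+ 2 <= sqnorm x.
  apply: ler_sum => i _; rewrite ler_piMl ?sqr_ge0 //.
  by have /andP[di di1] := dd i; nra.
have := sqr_ge0 (coord_sum x); nra.
Qed.

Lemma potential_le {R : realType} {n : nat} (x : 'cV[R]_n) :
  potential x <= (1 + 8 * n%:R) * euclid_norm x ^+ 2.
Proof.
rewrite /euclid_norm sqr_sqrtr; last by apply: sumr_ge0 => i _; rewrite sqr_ge0.
rewrite -/(sqnorm x) /potential [leRHS]mulrDl mul1r lerD2l -mulrA ler_wpM2l //.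
rewrite expr2 [X in X * _]/coord_sum mulr_suml /sqnorm.
(* The square of a sum of [n] terms is compared with a double sum, as in
   the proof of the Cauchy-Schwarz inequality by squares of differences. *)
have -> : n%:R * (\sum_i x i 0 ^+ 2) =
   2^-1 * \sum_(i < n) \sum_(j < n) (x i 0 ^+ 2 + x j 0 ^+ 2).
  under [in RHS]eq_bigr => i _ do
    rewrite big_split /= sumr_const card_ord -[_ *+ n]mulr_natl.
  rewrite big_split /= -mulr_sumr sumr_const card_ord -[_ *+ n]mulr_natl; lra.
rewrite mulr_sumr; apply: ler_sum => i _.
rewrite [X in _ * X]/coord_sum !mulr_sumr; apply: ler_sum => j _.
by have := sqr_ge0 (x i 0 - x j 0); lra.
Qed.

Lemma transfer_bounds {R : realType} {n : nat} {eps delta : R} {d : 'rV[R]_n} i :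
  0 <= delta <= 1 -> 0 <= eps -> 0 <= d 0 i <= 1 ->
  delta <= transfer eps delta d i <= delta + eps.
Proof.
move=> /andP[d0 d1] e0 /andP[di0 di1]; rewrite /transfer.
have z : 0 <= eps * d 0 i by rewrite mulr_ge0.
rewrite ler_pdivlMr ?ler_pdivrMr; [|lra..].
by apply/andP; split; nra.
Qed.

(** The constant 140 leaves room for the second-order term: with
    [delta <= eps] the factor of [epoch_avg] is at most
    [1 - 2 * delta + 84 * eps ^+ 2], and [84 / 140] is the slack [0.6] between
    the rates [2 * delta] and [1.4 * delta]. *)
Lemma epoch_contraction {R : realType} {n : nat} (eps delta : R) (d : 'rV[R]_n)
    (x : 'cV[R]_n) :
  (2 <= n)%N -> 0 < delta -> delta <= eps -> eps <= 1 / 20 ->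
  140 * eps ^+ 2 <= delta -> (forall i, 0 <= d 0 i <= 1) ->
  \sum_(s : 'S_n) potential (cd_epoch (A_eps eps delta d) s x) <=
  n`!%:R * (1 - 14 / 10 * delta) * potential x.
Proof.
move=> n2 d0 de e20 small dd.
have bds i : delta <= transfer eps delta d i <= delta + eps.
  by apply: transfer_bounds => //; lra.
have B4 : delta + eps <= 1 / 4 by lra.
rewrite (eq_bigr (fun s : 'S_n => potential (foldl
   (fun y j => relax (transfer eps delta d) y (s j)) x (enum 'I_n)))); last first.
  move=> s _; congr potential; rewrite /cd_epoch.
  elim: (enum 'I_n) x => //= j l IHl x; rewrite IHl cd_step_relax //.
  by have /andP[dj _] := dd (s j); have := mulr_ge0 (ltW (lt_le_trans d0 de)) dj; lra.
apply: le_trans (epoch_avg _ _ _ x n2 (ltW d0) bds B4) _.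
rewrite -mulrA ler_wpM2l ?ler0n // /potential.
have S0 : 0 <= sqnorm x by apply: sumr_ge0 => i _; rewrite sqr_ge0.
have X0 := sqr_ge0 (coord_sum x).
have : 1 - 2 * delta + 21 * (delta + eps) ^+ 2 <= 1 - 14 / 10 * delta by nra.
move=> H; have := ler_wpM2r S0 H; nra.
Qed.

Theorem theorem3p9 (R : realType) :
  exists2 rho_star : R, 0 < rho_star &
  forall rho : R, rho_star <= rho ->
  forall (n : nat) (eps delta : R) (d : 'rV[R]_n),
    (5 <= n)%N ->
    0 < delta -> delta <= eps ->
    n%:R * eps <= 1 ->
    rho_hat rho * eps ^+ 2 <= delta / 2 ->
    (forall i, 0 <= d 0 i) -> (exists i, d 0 i = 0) ->
    (forall i, d 0 i <= 1) -> (exists i, d 0 i = 1) ->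
  exists2 C : R, 0 < C &
  forall x0 : 'cV[R]_n,
    (forall (disp : measure_display) (T : measurableType disp)
        (P : probability T R) (sigma : nat -> T -> 'S_n),
      iid_uniform_perms P sigma ->
      forall t : nat, (1 <= t)%N ->
        ('E_P[fun w => quad (A_eps eps delta d)
                (rpcd (A_eps eps delta d) (fun l => sigma l w) x0 t)]
         <= (epoch_bound C eps delta x0 t)%:E)%E) /\
    (x0 != 0 ->
      (fun t : nat => epoch_bound C eps delta x0 t.+1
                      / epoch_bound C eps delta x0 t) @ \oo
        --> 1 - 14 / 10 * delta).
Proof.
(* [rho_hat 10] exceeds 70, which makes [eps ^+ 2] at most [delta / 140]. *)
exists 10; first by [].
move=> rho rho10 n eps delta d n5 d0 de _ Hrho dge0 _ dle1 _.
have e0 : 0 < eps := lt_le_trans d0 de.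
have dd i : 0 <= d 0 i <= 1 by rewrite dge0 dle1.
have small : 140 * eps ^+ 2 <= delta.
  have rho2 : 100 <= rho ^+ 2 by nra.
  have rho3 : 0 <= rho ^+ 3 by rewrite exprn_ge0 //; lra.
  have : 70 <= rho_hat rho by rewrite /rho_hat; lra.
  have := sqr_ge0 eps; nra.
have e20 : eps <= 1 / 20 by nra.
have n0 : 0 < 1 + 8 * n%:R :> R by have := ler0n R n; lra.
set A := A_eps eps delta d; set r := 1 - 14 / 10 * delta.
have r0 : 0 < r by rewrite /r; lra.
exists ((1 + 8 * n%:R) / eps); first by rewrite divr_gt0.
move=> x0; split=> [disp T P sigma iid t t1|x0_neq0].
- have qb y : 0 <= quad A y <= potential y by apply: quad_A_eps_bounds => //; lra.
  under eq_fun => w do rewrite rpcd_foldl.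
  rewrite (expectation_iid_perms t (fun u => quad A (foldl _ x0 u))) //; last first.
    by move=> u; have /andP[] := qb (foldl (fun y p => cd_epoch A p y) x0 u).
  rewrite lee_fin.
  have contr y : \sum_(s : 'S_n) potential (cd_epoch A s y) <= n`!%:R * r * potential y.
    by apply: epoch_contraction => //; exact: leq_trans n5.
  have nr0 : 0 <= n`!%:R * r by rewrite mulr_ge0 ?ler0n // ltW.
  have qV y : quad A y <= potential y by have /andP[] := qb y.
  have H := sum_tuple_foldl_le (fun y p => cd_epoch A p y) _ _ _ nr0 qV contr t x0.
  have nf : 0 < n`!%:R :> R by rewrite ltr0n fact_gt0.
  apply: le_trans (ler_wpM2l _ H) _; first by rewrite exprn_ge0 // invr_ge0 ltW.
  rewrite mulrA exprMn mulrA -exprMn mulVf ?gt_eqF // expr1n mul1r.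
  have E : epoch_bound ((1 + 8 * n%:R) / eps) eps delta x0 t =
      r ^+ t * ((1 + 8 * n%:R) * euclid_norm x0 ^+ 2) * t%:R.
    by rewrite /epoch_bound -/r; field; rewrite gt_eqF.
  rewrite E; apply: le_trans (ler_wpM2l (ltW (exprn_gt0 t r0)) (potential_le x0)) _.
  apply: ler_peMr; last by rewrite ler1n.
  by rewrite !mulr_ge0 ?exprn_ge0 ?sqrtr_ge0 ?(ltW n0) ?(ltW r0).
- have N0 : euclid_norm x0 ^+ 2 != 0.
    apply: contra x0_neq0; rewrite sqrf_eq0 sqrtr_eq0 => S.
    have : \sum_i x0 i 0 ^+ 2 == 0.
      by rewrite eq_le S sumr_ge0 // => i _; rewrite sqr_ge0.
    rewrite psumr_eq0; last by move=> i _; rewrite sqr_ge0.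
    move=> /allP z; apply/eqP/colP => i; rewrite mxE; apply/eqP.
    by have := z i (mem_index_enum i); rewrite sqrf_eq0.
  (* At [t = 0] the bound vanishes and the quotient is a default value, hence the
     shift. *)
  rewrite -cvg_shiftS /=.
  have -> : (fun t => epoch_bound ((1 + 8 * n%:R) / eps) eps delta x0 t.+2 /
        epoch_bound ((1 + 8 * n%:R) / eps) eps delta x0 t.+1) =
      (fun t => r * (1 + t.+1%:R^-1)).
    apply/funext => t; rewrite /epoch_bound -/r.
    rewrite [r ^+ t.+2]exprS -[t.+2]addn1 natrD.
    have : r ^+ t.+1 != 0 by rewrite expf_neq0 // gt_eqF.
    move: (r ^+ t.+1) (euclid_norm x0 ^+ 2) N0 => u v v0 u0.
    have : t.+1%:R != 0 :> R by rewrite pnatr_eq0.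
    move: t.+1%:R => m m0; field.
    by rewrite m0 v0 u0 !gt_eqF.
  suff : (fun t : nat => r * (1 + t.+1%:R^-1)) @ \oo --> r * (1 + 0).
    by rewrite addr0 mulr1.
  apply: cvgM; first exact: cvg_cst.
  apply: cvgD; first exact: cvg_cst.
  exact: cvg_harmonic.
Qed.
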